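(* Suppose that the following hold. (A-1) There exists $S<\infty$ such that $S_p\le S$ for all $p$. (A-2) There exists $m>0$ such that $p^m\omega_p$ is bounded, that is, $\omega_p\le H/p^m$ for some $H<\infty$. (A-3) For a given $t\in[0,1]$ there exists $b_t$ such that $p^{-b_t}\alpha_{n,p}(t)$ is bounded for all $n$ and $p$. (A-4) There exists $c$ such that $p^{-c}\sup_t\alpha_{n,p}(t)$ is bounded for all $n$ and $p$. (A-5) There exists a $p^*$ such that $\delta^{V_{n,p^*}}_{2S}+\theta^{V_{n,p^*}}_{S,2S}$ is bounded away from one (from below one) for large enough $n$. Suppose also that $\varepsilon_1^*,\dots,\varepsilon_n^*$ are independent with $\varepsilon_i^*\sim N(0,\sigma_2^2)$. Fix $p=p^*$ and, for $\phi\ge0$, let $\widehat\beta_n$ be the FLiRTI estimate based on $n$ observations, computed (with the Dantzig selector or the lasso) with $p=p^*$ and $\lambda=\sigma_2\sqrt{2(1+\phi)\log p}$. Suppose that $\boldsymbol\gamma_p=A\boldsymbol\eta_p$ has at most $S_p$ non-zero components, $\delta^{V_{n,p}}_{2S_p}+\theta^{V_{n,p}}_{S_p,2S_p}<1$, and, if the lasso is used, $\mathbf{u}=(D_\lambda\tilde V^T\tilde VD_\lambda)^{-1}\mathbf{1}\ge\mathbf{0}$ and $\|\tilde V^T\tilde VD_\lambda\mathbf{u}\|_\infty\le1$ (with $V=V_{n,p}$). Then, with arbitrarily high probability, as $n\to\infty$, $$|\widehat\beta_n(t)-\beta(t)|\le O(n^{-1/2})+\frac{H}{p^{*m}}\qquad\text{and}\qquad\sup_t|\widehat\beta_n(t)-\beta(t)|\le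 O(n^{-1/2})+\frac{H}{p^{*m}}.$$ Here ''with arbitrarily high probability'' means that the probability converges to one as $\phi\to\infty$: for every $\rho>0$ there is $\phi_0$ such that for each $\phi\ge\phi_0$ there are $K<\infty$ and $N$ such that, for all $n\ge N$, with probability at least $1-\rho$ each of the two inequalities holds with $O(n^{-1/2})$ replaced by $Kn^{-1/2}$.
   Context: Model: for each $n$, $Y_i=\int_0^1X_i(t)\beta(t)\,dt+\varepsilon_i$, $i=1,\dots,n$ (the intercept is taken to be $0$), where $X_i:[0,1]\to\mathbb{R}$ are functional predictors, $\beta:[0,1]\to\mathbb{R}$ is the fixed coefficient function and $\varepsilon_i$ are random errors. Distributional statements are conditional on the $X_i$ (which may be treated as fixed). For each $p$, $\mathbf{B}_p(t)=(b_1(t),\dots,b_p(t))^T$ is a given $p$-dimensional basis on $[0,1]$, $\boldsymbol{\eta}_p\in\mathbb{R}^p$, $e_p(t)=\beta(t)-\mathbf{B}_p(t)^T\boldsymbol{\eta}_p$, $\omega_p=\sup_{0\le t\le1}|e_p(t)|$, $A$ (depending on $p$) is an invertible $p\times p$ matrix, $\boldsymbol{\gamma}_p=A\boldsymbol{\eta}_p$, and $S_p$ bounds the number of non-zero components of $\boldsymbol\gamma_p$. All integrals are assumed to exist; $t$ ranges over $[0,1]$ in suprema. Put $\mathbf{X}_i=\int_0^1X_i(t)\mathbf{B}_p(t)\,dt\in\mathbb{R}^p$, let $X$ be the $n\times p$ matrix with rows $\mathbf{X}_i^T$, let $V=V_{n,p}=XA^{-1}$, and let $\varepsilon_i^*=\varepsilon_i+\int_0^1X_i(t)e_p(t)\,dt$,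 so that $\mathbf{Y}=V\boldsymbol{\gamma}_p+\boldsymbol{\varepsilon}^*$. The columns of $V$ are assumed non-zero; $\tilde V$ is $V$ with each column divided by its Euclidean norm, and $\tilde V_j$ is its $j$th column. FLiRTI estimate with tuning parameter $\lambda$: let $\widehat{\tilde{\boldsymbol\gamma}}$ be either a lasso solution, minimizing $\frac12\|\mathbf{Y}-\tilde V\mathbf{g}\|_2^2+\lambda\|\mathbf{g}\|_1$ over $\mathbf{g}\in\mathbb{R}^p$, or a Dantzig selector solution, minimizing $\|\mathbf{g}\|_1$ subject to $|\tilde V_j^T(\mathbf{Y}-\tilde V\mathbf{g})|\le\lambda$ for $j=1,\dots,p$. Then $\widehat{\boldsymbol\gamma}$ is obtained by dividing the $j$th component of $\widehat{\tilde{\boldsymbol\gamma}}$ by the Euclidean norm of the $j$th column of $V$, and $\widehat\beta(t)=\mathbf{B}_p(t)^TA^{-1}\widehat{\boldsymbol\gamma}$. $D_\lambda$ is the diagonal matrix with $j$th diagonal entry $1,-1$ or $0$ according to whether the $j$th component of the lasso solution with tuning parameter $\lambda$ is positive, negative or zero; $\mathbf{1}$ is a vector of ones; vector inequalities are componentwise; the inverse of $D_\lambda\tilde V^T\tilde VD_\lambda$ is understood on the coordinates where the diagonal of $D_\lambda$ is non-zero. For an $n\times p$ matrix $Z$ and $T\subset\{1,\dots,p\}$, $Z_T$ is the $n\times|T|$ matrix obtained by standardizing the columns of $Z$ to Euclidean norm one and extracting those with indices in $T$. $\delta^Z_S$ is the smallest quantity such that $(1-\delta_S^Z)\|\mathbf{c}\|_2^2\le\|Z_T\mathbf{c}\|_2^2\le(1+\delta_S^Z)\|\mathbf{c}\|_2^2$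 for all $T$ with $|T|\le S$ and all $\mathbf{c}\in\mathbb{R}^{|T|}$. For $S+S'\le p$, $\theta^Z_{S,S'}$ is the smallest quantity such that $|(Z_T\mathbf{c})^TZ_{T'}\mathbf{c}'|\le\theta^Z_{S,S'}\|\mathbf{c}\|_2\|\mathbf{c}'\|_2$ for all disjoint $T,T'$ with $|T|\le S$, $|T'|\le S'$ and all vectors $\mathbf{c},\mathbf{c}'$ of corresponding lengths. Finally, $$\alpha_{n,p}(t)=\sqrt{\sum_{j=1}^p\frac{(\mathbf{B}_p(t)^TA_j^{-1})^2}{\frac1n\sum_{i=1}^n\left(\int_0^1X_i(s)\mathbf{B}_p(s)^TA_j^{-1}\,ds\right)^2}},$$ where $A_j^{-1}$ is the $j$th column of $A^{-1}$. *)

(* Defs.v *)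
From mathcomp Require Export all_boot all_order all_algebra.
From mathcomp Require Export all_classical all_reals all_analysis.
Export Order.TTheory GRing.Theory Num.Theory.
Export numFieldNormedType.Exports.

Set Implicit Arguments.
Unset Strict Implicit.
Unset Printing Implicit Defensive.

Local Open Scope classical_set_scope.
Local Open Scope ring_scope.

Definition l1norm (R : realType) n (c : 'cV[R]_n) : R := \sum_i `|c i 0|.
Definition l2norm (R : realType) n (c : 'cV[R]_n) : R :=
  Num.sqrt (\sum_i c i 0 ^+ 2).

Definition nnz (R : realType) n (c : 'cV[R]_n) : nat :=
  #|[set i | c i 0 != 0]%SET|.

Definition standardize (R : realType) n p (Z : 'M[R]_(n, p)) : 'M[R]_(n, p) :=
  \matrix_(i, j) (Z i j / l2norm (col j Z)).

(* Z_T: the columns of Z are standardized first, then those in T are kept. *)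
Definition std_cols (R : realType) n p (Z : 'M[R]_(n, p)) (T : {set 'I_p}) :
    'M[R]_(n, #|T|) :=
  colsub (fun k : 'I_#|T| => enum_val k) (standardize Z).

(* The admissible values in the next two definitions form closed upward rays,
   so inf is the smallest one; only in degenerate cases (such as S = 0), where
   every real number is admissible, inf takes its default value 0. *)
Definition delta (R : realType) n p (Z : 'M[R]_(n, p)) (S : nat) : R :=
  inf [set d : R | forall T : {set 'I_p}, (#|T| <= S)%N ->
    forall c : 'cV[R]_#|T|,
      (1 - d) * l2norm c ^+ 2 <= l2norm (std_cols Z T *m c) ^+ 2
        <= (1 + d) * l2norm c ^+ 2].

Definition theta (R : realType) n p (Z : 'M[R]_(n, p)) (S S' : nat) : R :=
  inf [set d : R | forall T T' : {set 'I_p},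
    (#|T| <= S)%N -> (#|T'| <= S')%N -> [disjoint T & T']%B ->
    forall (c : 'cV[R]_#|T|) (c' : 'cV[R]_#|T'|),
      `|((std_cols Z T *m c)^T *m (std_cols Z T' *m c')) 0 0|
        <= d * l2norm c * l2norm c'].

Definition int01 (R : realType) (f : R -> R) : R :=
  \int[@lebesgue_measure R]_(t in `[0, 1]) f t.

Definition integrable01 (R : realType) (f : R -> R) : Prop :=
  (@lebesgue_measure R).-integrable `[0, 1] (EFin \o f).

(* Extended-real valued, hence +oo when f is unbounded above on [0, 1]. *)
Definition sup01 (R : realType) (f : R -> R) : \bar R :=
  ereal_sup [set (f t)%:E | t in `[0, 1]].

Definition basis_row (R : realType) p (b : 'I_p -> R -> R) (t : R) : 'rV[R]_p :=
  \row_j b j t.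

Definition residual (R : realType) p (beta : R -> R) (b : 'I_p -> R -> R)
    (eta : 'cV[R]_p) (t : R) : R :=
  beta t - (basis_row b t *m eta) 0 0.

Definition omega (R : realType) p (beta : R -> R) (b : 'I_p -> R -> R)
    (eta : 'cV[R]_p) : \bar R :=
  sup01 (fun t => `|residual beta b eta t|).

Definition Vmat (R : realType) n p (x : 'I_n -> R -> R) (b : 'I_p -> R -> R)
    (A : 'M[R]_p) : 'M[R]_(n, p) :=
  (\matrix_(i, j) int01 (fun t => x i t * b j t)) *m invmx A.

Definition alpha (R : realType) n p (x : 'I_n -> R -> R) (b : 'I_p -> R -> R)
    (A : 'M[R]_p) (t : R) : R :=
  let BAinv s j := (basis_row b s *m col j (invmx A)) 0 0 in
  Num.sqrt (\sum_j BAinv t j ^+ 2 /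
    (n%:R^-1 * \sum_i int01 (fun s => x i s * BAinv s j) ^+ 2)).

Definition response (R : realType) n (W : Type) (x : 'I_n -> R -> R)
    (beta : R -> R) (eps : 'I_n -> W -> R) (w : W) : 'cV[R]_n :=
  \col_i (int01 (fun t => x i t * beta t) + eps i w).

Definition eps_star (R : realType) n p (W : Type) (x : 'I_n -> R -> R)
    (beta : R -> R) (b : 'I_p -> R -> R) (eta : 'cV[R]_p)
    (eps : 'I_n -> W -> R) (i : 'I_n) (w : W) : R :=
  eps i w + int01 (fun t => x i t * residual beta b eta t).

Definition lasso_solution (R : realType) n p (Z : 'M[R]_(n, p)) (y : 'cV[R]_n)
    (lam : R) (g : 'cV[R]_p) : Prop :=
  let obj h := l2norm (y - Z *m h) ^+ 2 / 2 + lam * l1norm h in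
  forall h, obj g <= obj h.

Definition dantzig_feasible (R : realType) n p (Z : 'M[R]_(n, p))
    (y : 'cV[R]_n) (lam : R) (g : 'cV[R]_p) : Prop :=
  forall j, `|((col j Z)^T *m (y - Z *m g)) 0 0| <= lam.

Definition dantzig_solution (R : realType) n p (Z : 'M[R]_(n, p))
    (y : 'cV[R]_n) (lam : R) (g : 'cV[R]_p) : Prop :=
  dantzig_feasible Z y lam g /\
  forall h, dantzig_feasible Z y lam h -> l1norm g <= l1norm h.

Definition sign_mx (R : realType) p (g : 'cV[R]_p) : 'M[R]_p :=
  diag_mx (\row_j Num.sg (g j 0)).

Definition submx_on (R : realType) p (J : {set 'I_p}) (M : 'M[R]_p) :
    'M[R]_#|J| :=
  mxsub (fun k : 'I_#|J| => enum_val k) (fun k : 'I_#|J| => enum_val k) M.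

(* The inverse of the J-block of M, padded with zeros outside J x J. *)
Definition inverse_on (R : realType) p (J : {set 'I_p}) (M : 'M[R]_p) :
    'M[R]_p :=
  let sel : 'M[R]_(#|J|, p) := rowsub (fun k : 'I_#|J| => enum_val k) 1%:M in
  sel^T *m invmx (submx_on J M) *m sel.

(* invmx is the identity on singular matrices, so existence of the inverse is
   an explicit conjunct. *)
Definition lasso_condition (R : realType) n p (Z : 'M[R]_(n, p))
    (g : 'cV[R]_p) : Prop :=
  let D := sign_mx g in
  let J : {set 'I_p} := [set j | D j j != 0]%SET in
  let M := D *m Z^T *m Z *m D in
  let u : 'cV[R]_p := inverse_on J M *m const_mx 1 in
  [/\ submx_on J M \in unitmx,
      forall j, 0 <= u j 0 &
      forall j, `|(Z^T *m Z *m D *m u) j 0| <= 1].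

(* V is the unstandardized design matrix; g solves the problem for
   standardize V. *)
Definition flirti (R : realType) n p (V : 'M[R]_(n, p)) (b : 'I_p -> R -> R)
    (A : 'M[R]_p) (g : 'cV[R]_p) (t : R) : R :=
  let gamma_hat : 'cV[R]_p := \col_j (g j 0 / l2norm (col j V)) in
  (basis_row b t *m invmx A *m gamma_hat) 0 0.

Definition independent (R : realType) (d : measure_display)
    (T : measurableType d) (P : probability T R) n (X : 'I_n -> T -> R) : Prop :=
  forall (J : {set 'I_n}) (B : 'I_n -> set R), (forall i, measurable (B i)) ->
    P (\bigcap_(i in [set` J]) (X i @^-1` B i)) =
      (\prod_(i in J) P (X i @^-1` B i))%E.

Definition has_law (R : realType) (d : measure_display)
    (T : measurableType d) (P : probability T R) (X : T -> R)
    (mu : set R -> \bar R) : Prop :=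
  forall B : set R, measurable B -> P (X @^-1` B) = mu B.

(* G need not be measurable: the estimate may be an arbitrary selection among
   the solutions.  For measurable G this is q <= P G. *)
Definition with_prob_at_least (R : realType) (d : measure_display)
    (T : measurableType d) (P : probability T R) (q : R) (G : set T) : Prop :=
  exists E : set T, [/\ measurable E, E `<=` G & (q%:E <= P E)%E].

(* Main.v *)
From HB Require Import structures.
Require Import Defs.
From mathcomp Require Import measurable_realfun ring lra zify.

(** Write [V] for the design matrix, [Z] for its standardization, [gamma] for
    the rescaled coefficient vector ([Z gamma = V A eta]) and [es] for the total
    noise, so that [Y = Z gamma + es].

    _Noise._ The entries of [es] are centred normal and pairwise uncorrelated,
    and the columns of [Z] have norm one; so the sum over the [p] columns of the
    squared correlations with [es] has expectation at most [p * 16 sigma^2], and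
    by Markov's inequality all correlations are at most a constant [M], depending
    on [p], [sigma] and [rho] only, with probability at least [1 - rho]
    ([normal_noise_bound]).  As [p] is fixed, second moments are enough and no
    Gaussian tail estimate is needed.  The second moment is bounded by comparing
    the density with that of a normal law of twice the standard deviation, and
    uncorrelatedness comes from the fact that [(X, Y)] and [(X, - Y)] have the
    same law when [X], [Y] are independent and [Y] is symmetric.

    _Deterministic part._ On that event, once [lambda] is a large enough
    multiple of [M], the part of the error [h] of either estimator off the
    support of [gamma] is dominated, in l1 norm, by the part on it, up to a
    factor [c > 1] as close to 1 as desired ([cone_condition]): for the Dantzig selector because [gamma] is
    feasible, for the lasso by comparing the objective at the solution and at
    [gamma].  Moreover every column of [Z] has correlation at most [lambda + M]
    with [Z h] ([correlation_error]).  The argument of Candes and Tao, which cuts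
    the complement of the support into blocks of decreasing entries
    ([shelling]), then bounds the l1 norm of [h] by a constant independent of [n]
    as soon as [delta + c theta] stays away from one; since
    [delta + theta <= kappa < 1], the choice [c = 1 + (1 - kappa) / 2] works
    ([l1_estimation_error]).  In particular the lasso is handled without
    comparing it with the Dantzig selector.

    _Conclusion._ The estimation error at [t] is at most [alpha t / sqrt n] times
    the l1 norm of [h], plus the approximation error [omega <= H / p ^ m]
    ([flirti_error]), and [alpha] is bounded for fixed [p].  The tuning parameter
    exceeds any given constant for large [phi], except when [p = 1], where it
    vanishes; then the bound on the correlations bounds [h] directly. *)

Set Implicit Arguments.
Unset Strict Implicit.
Unset Printing Implicit Defensive.

Local Open Scope classical_set_scope.
Local Open Scope ring_scope.

(** * Euclidean vectors and restrictions to index sets *)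

(** Euclidean inner product. *)
Definition dot (R : realType) n (u v : 'cV[R]_n) : R := \sum_i u i 0 * v i 0.

(** The vector [h] with its coordinates outside [T] replaced by zero. *)
Definition vmask (R : realType) p (T : {set 'I_p}) (h : 'cV[R]_p) : 'cV[R]_p :=
  \col_j (if j \in T then h j 0 else 0).

Section Euclidean.
Variables (R : realType) (n : nat).
Implicit Types u v w : 'cV[R]_n.

Lemma dotE u v : dot u v = (u^T *m v) 0 0.
Proof. by rewrite mxE; apply: eq_bigr => i _; rewrite !mxE. Qed.

Lemma dotC u v : dot u v = dot v u.
Proof. by apply: eq_bigr => i _; rewrite mulrC. Qed.

Lemma dotDr u v w : dot u (v + w) = dot u v + dot u w.
Proof.
by rewrite /dot -big_split; apply: eq_bigr => i _; rewrite mxE mulrDr.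
Qed.

Lemma dotZr a u v : dot u (a *: v) = a * dot u v.
Proof.
by rewrite /dot mulr_sumr; apply: eq_bigr => i _; rewrite mxE mulrCA.
Qed.

Lemma dotBr u v w : dot u (v - w) = dot u v - dot u w.
Proof. by rewrite dotDr -scaleN1r dotZr mulN1r. Qed.

Lemma dotBl u v w : dot (v - w) u = dot v u - dot w u.
Proof. by rewrite dotC dotBr !(dotC u). Qed.

Lemma dotZl a u v : dot (a *: u) v = a * dot u v.
Proof. by rewrite dotC dotZr dotC. Qed.

Lemma l2norm_ge0 u : 0 <= l2norm u.
Proof. exact: sqrtr_ge0. Qed.

Lemma sqr_l2norm u : l2norm u ^+ 2 = dot u u.
Proof.
rewrite sqr_sqrtr; last by apply: sumr_ge0 => i _; exact: sqr_ge0.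
by apply: eq_bigr => i _; rewrite expr2.
Qed.

Lemma dot_ge0 u : 0 <= dot u u.
Proof. by rewrite -sqr_l2norm sqr_ge0. Qed.

Lemma dot_eq0 u : dot u u = 0 -> u = 0.
Proof.
move=> u0; apply/matrixP => i j; rewrite ord1 mxE; apply/eqP.
have := u0; rewrite /dot => /eqP; rewrite psumr_eq0 => [|k _].
  by move=> /allP /(_ i); rewrite mem_index_enum mulf_eq0 orbb => /(_ isT).
by rewrite -expr2 sqr_ge0.
Qed.

Lemma l2norm_eq0 u : (l2norm u == 0) = (u == 0).
Proof.
apply/eqP/eqP => [u0|->]; last first.
  by rewrite /l2norm big1 ?sqrtr0// => i _; rewrite mxE expr0n.
by apply: dot_eq0; rewrite -sqr_l2norm u0 expr0n.
Qed.

Lemma cauchy_schwarz_dot u v : `|dot u v| <= l2norm u * l2norm v.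
Proof.
have [v0|v0] := eqVneq v 0.
  rewrite v0 /dot big1 ?normr0 ?mulr_ge0 ?l2norm_ge0// => i _.
  by rewrite mxE mulr0.
rewrite -(@ler_pXn2r _ 2%N) ?nnegrE ?mulr_ge0 ?l2norm_ge0 ?normr_ge0//.
rewrite exprMn !sqr_l2norm real_normK ?num_real//.
have vv : 0 < dot v v.
  by rewrite lt_neqAle dot_ge0 eq_sym andbT; apply: contra_neq v0 => /dot_eq0.
have := dot_ge0 (dot v v *: u - dot u v *: v).
rewrite dotBl !dotBr !dotZl !dotZr (dotC v u).
have -> : dot v v * (dot v v * dot u u) - dot v v * (dot u v * dot u v) -
  (dot u v * (dot v v * dot u v) - dot u v * (dot u v * dot v v)) =
  dot v v * (dot u u * dot v v - dot u v ^+ 2) by ring.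
by rewrite pmulr_rge0// subr_ge0.
Qed.

End Euclidean.

Lemma dot_mulmx (R : realType) n p (Z : 'M[R]_(n, p)) (u : 'cV[R]_n)
    (h : 'cV[R]_p) :
  dot u (Z *m h) = \sum_j h j 0 * dot (col j Z) u.
Proof.
rewrite /dot; under eq_bigr do rewrite mxE mulr_sumr.
rewrite exchange_big; apply: eq_bigr => j _; rewrite mulr_sumr.
by apply: eq_bigr => i _; rewrite mxE; ring.
Qed.

Section Masks.
Variables (R : realType) (p : nat).
Implicit Types (h : 'cV[R]_p) (T U : {set 'I_p}).

Lemma sqr_l2norm_vmask T h : l2norm (vmask T h) ^+ 2 = \sum_(j in T) h j 0 ^+ 2.
Proof.
rewrite sqr_l2norm [RHS]big_mkcond; apply: eq_bigr => j _.
by rewrite mxE; case: ifP => _; rewrite ?mul0r// expr2.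
Qed.

Lemma vmask_disjoint T U h : [disjoint T & U]%B ->
  vmask (T :|: U) h = vmask T h + vmask U h.
Proof.
move=> TU; apply/matrixP => j k; rewrite !mxE inE.
have [jT|jT] /= := boolP (j \in T); last by rewrite add0r.
by rewrite (disjointFr TU jT) addr0.
Qed.

Lemma le_l2norm_vmask T U h : T \subset U ->
  l2norm (vmask T h) <= l2norm (vmask U h).
Proof.
move=> TU.
rewrite -(@ler_pXn2r _ 2%N) ?nnegrE ?l2norm_ge0// !sqr_l2norm_vmask.
rewrite [leRHS](big_setID T) /= (finset.setIidPr TU) lerDl sumr_ge0// => j _.
exact: sqr_ge0.
Qed.

Lemma sum_vmask_le_l2norm T k h : (#|T| <= k)%N ->
  \sum_(j in T) `|h j 0| <= Num.sqrt k%:R * l2norm (vmask T h).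
Proof.
move=> Tk.
pose one : 'cV[R]_p := vmask T (const_mx 1).
pose a : 'cV[R]_p := vmask T (\col_j `|h j 0|).
have -> : \sum_(j in T) `|h j 0| = dot one a.
  rewrite big_mkcond; apply: eq_bigr => j _; rewrite !mxE.
  by case: ifP; rewrite ?mul1r ?mul0r.
apply: le_trans (ler_norm _) (le_trans (cauchy_schwarz_dot _ _) _).
have -> : l2norm a = l2norm (vmask T h).
  congr Num.sqrt; apply: eq_bigr => j _; rewrite !mxE.
  by case: ifP => // _; rewrite real_normK ?num_real.
apply: ler_wpM2r; first exact: l2norm_ge0.
apply: ler_wsqrtr.
rewrite (eq_bigr (fun j => if j \in T then 1 else 0 : R)) => [|j _]; last first.
  by rewrite !mxE; case: ifP; rewrite ?expr1n ?expr0n.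
by rewrite -big_mkcond sumr_const /= ler_nat.
Qed.

Lemma l1norm_split T h :
  l1norm h = \sum_(j in T) `|h j 0| + \sum_(j in ~: T) `|h j 0|.
Proof.
rewrite /l1norm (bigID (fun j => j \in T)) /=; congr (_ + _).
by apply: eq_bigl => j; rewrite inE.
Qed.

End Masks.

(** * Restricted isometry and orthogonality constants *)

Section RestrictedIsometry.
Variables (R : realType) (n p : nat) (Z : 'M[R]_(n, p)).
Implicit Types (h : 'cV[R]_p) (T U : {set 'I_p}).
Let Zs := standardize Z.

(** The coordinates of [h] in [T], as a vector indexed by ['I_#|T|], the form
    in which the restricted isometry constants take their arguments. *)
Definition subvec T h : 'cV[R]_#|T| := \col_k h (enum_val k) 0.

Lemma std_cols_subvec T h : std_cols Z T *m subvec T h = Zs *m vmask T h.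
Proof.
apply/matrixP => i k; rewrite !mxE.
rewrite [RHS](bigID (fun j => j \in T)) /= [X in _ + X]big1 ?addr0; last first.
  by move=> j /negbTE jT; rewrite !mxE jT mulr0.
rewrite [RHS](eq_bigr (fun j => Zs i j * h j 0)) => [|j jT]; last first.
  by rewrite !mxE jT.
rewrite [RHS]big_enum_val /=.
by apply: eq_bigr => j _; rewrite !mxE.
Qed.

Lemma l2norm_subvec T h : l2norm (subvec T h) = l2norm (vmask T h).
Proof.
apply/eqP; rewrite -(@eqrXn2 _ 2%N) ?l2norm_ge0// sqr_l2norm_vmask.
rewrite sqr_l2norm; apply/eqP; rewrite [RHS]big_enum_val /=.
by apply: eq_bigr => j _; rewrite !mxE expr2.
Qed.

Lemma subvec_surj T (c : 'cV[R]_#|T|) : exists h, c = subvec T h.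
Proof.
exists (\col_j \sum_(k | enum_val k == j) c k 0).
apply/matrixP => k l; rewrite ord1 !mxE (big_pred1 k)// => i /=.
exact: (inj_eq enum_val_inj).
Qed.

(** Squared Frobenius norm of the standardized matrix: a crude operator bound,
    which shows that the infima [delta] and [theta] range over nonempty sets. *)
Definition frob : R := \sum_i \sum_j Zs i j ^+ 2.

Lemma frob_ge0 : 0 <= frob.
Proof. by apply: sumr_ge0 => i _; apply: sumr_ge0 => j _; exact: sqr_ge0. Qed.

Lemma l2norm_mulmx_le h : l2norm (Zs *m h) ^+ 2 <= frob * l2norm h ^+ 2.
Proof.
rewrite sqr_l2norm /dot /frob mulr_suml; apply: ler_sum => i _.
have -> : (Zs *m h) i 0 = dot (row i Zs)^T h.
  by rewrite mxE; apply: eq_bigr => j _; rewrite !mxE.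
rewrite -expr2 -[leLHS]real_normK ?num_real//.
have -> : \sum_j Zs i j ^+ 2 = l2norm (row i Zs)^T ^+ 2.
  by rewrite sqr_l2norm; apply: eq_bigr => j _; rewrite !mxE expr2.
by rewrite -exprMn lerXn2r ?nnegrE ?mulr_ge0 ?l2norm_ge0 ?cauchy_schwarz_dot.
Qed.

Lemma dot_mulmx_le h h' :
  `|dot (Zs *m h) (Zs *m h')| <= frob * l2norm h * l2norm h'.
Proof.
apply: le_trans (cauchy_schwarz_dot _ _) _.
rewrite -(@ler_pXn2r _ 2%N) ?nnegrE ?mulr_ge0 ?l2norm_ge0 ?frob_ge0//.
rewrite !exprMn.
apply: (le_trans (ler_pM (sqr_ge0 _) (sqr_ge0 _) (l2norm_mulmx_le h)
                         (l2norm_mulmx_le h'))).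
by rewrite le_eqVlt; apply/orP; left; apply/eqP; ring.
Qed.

Lemma delta_nonempty S : [set d : R | forall T : {set 'I_p}, (#|T| <= S)%N ->
    forall c : 'cV[R]_#|T|,
      (1 - d) * l2norm c ^+ 2 <= l2norm (std_cols Z T *m c) ^+ 2
        <= (1 + d) * l2norm c ^+ 2] !=set0.
Proof.
exists (1 + frob) => U _ c; have [g ->] := subvec_surj c.
rewrite std_cols_subvec l2norm_subvec.
have h2 := sqr_ge0 (l2norm (vmask U g)).
have f0 := frob_ge0.
apply/andP; split.
  apply: le_trans (sqr_ge0 _).
  by rewrite opprD addNKr mulNr oppr_le0 mulr_ge0.
apply: le_trans (l2norm_mulmx_le _) _; apply: ler_wpM2r => //; lra.
Qed.

(** The infimum [delta] is itself an admissible constant for the lower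
    isometry bound. *)
Lemma delta_lower S T h : (#|T| <= S)%N ->
  (1 - delta Z S) * l2norm (vmask T h) ^+ 2 <= l2norm (Zs *m vmask T h) ^+ 2.
Proof.
move=> TS; rewrite -std_cols_subvec -l2norm_subvec.
have := l2norm_ge0 (subvec T h); rewrite le_eqVlt => /predU1P[<-|h0].
  by rewrite expr0n mulr0 sqr_ge0.
rewrite -ler_pdivlMr ?exprn_gt0// lerBlDl -lerBlDr.
apply: lb_le_inf; first exact: delta_nonempty.
move=> d /(_ T TS (subvec T h)) /andP[+ _].
by rewrite -ler_pdivlMr ?exprn_gt0// lerBlDl -lerBlDr.
Qed.

Lemma theta_nonempty S S' : [set d : R | forall T T' : {set 'I_p},
    (#|T| <= S)%N -> (#|T'| <= S')%N -> [disjoint T & T']%B ->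
    forall (c : 'cV[R]_#|T|) (c' : 'cV[R]_#|T'|),
      `|((std_cols Z T *m c)^T *m (std_cols Z T' *m c')) 0 0|
        <= d * l2norm c * l2norm c'] !=set0.
Proof.
exists frob => T U _ _ _ c c'.
have [g ->] := subvec_surj c; have [g' ->] := subvec_surj c'.
by rewrite !std_cols_subvec !l2norm_subvec -dotE dot_mulmx_le.
Qed.

(** Likewise, the infimum [theta] is an admissible constant. *)
Lemma theta_upper S S' T U h h' : (#|T| <= S)%N -> (#|U| <= S')%N ->
  [disjoint T & U]%B ->
  `|dot (Zs *m vmask T h) (Zs *m vmask U h')| <=
    theta Z S S' * l2norm (vmask T h) * l2norm (vmask U h').
Proof.
move=> TS US TU; rewrite -!std_cols_subvec -!l2norm_subvec dotE -mulrA.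
set N := _ * l2norm _.
have : 0 <= N by rewrite mulr_ge0 ?l2norm_ge0.
rewrite le_eqVlt => /predU1P[N0|N0]; last first.
  rewrite -ler_pdivrMr//; apply: lb_le_inf; first exact: theta_nonempty.
  move=> d /(_ T U TS US TU (subvec T h) (subvec U h')).
  by rewrite -mulrA -ler_pdivrMr.
have [d /(_ T U TS US TU (subvec T h) (subvec U h'))] :=
  theta_nonempty S S'.
by rewrite -mulrA -/N -N0 !mulr0.
Qed.

(** With [S = 0] every real number is admissible; the positivity of [S] excludes
    this case, here and in [theta_ge0]. *)
Lemma delta_ge0 S : (0 < S)%N -> (0 < p)%N -> 0 <= delta Z S.
Proof.
move=> S0 p0; pose j := Ordinal p0.
have jS : (#|[set j]%SET| <= S)%N by rewrite cards1.
apply: lb_le_inf; first exact: delta_nonempty.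
move=> d /(_ _ jS (subvec _ (const_mx 1))) /andP[h1 h2].
have := le_trans h1 h2.
rewrite l2norm_subvec sqr_l2norm_vmask big_set1 mxE expr1n; lra.
Qed.

Lemma theta_ge0 S S' : (0 < S)%N -> (0 < S')%N -> (1 < p)%N ->
  0 <= theta Z S S'.
Proof.
move=> S0 S'0 p1; pose i := Ordinal (ltnW p1); pose j := Ordinal p1.
have iS : (#|[set i]%SET| <= S)%N by rewrite cards1.
have jS : (#|[set j]%SET| <= S')%N by rewrite cards1.
have ij : [disjoint [set i]%SET & [set j]%SET]%B.
  by rewrite disjoints1 inE.
apply: lb_le_inf; first exact: theta_nonempty.
move=> d /(_ _ _ iS jS ij (subvec _ (const_mx 1)) (subvec _ (const_mx 1))).
move=> /(le_trans (normr_ge0 _)).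
have one k : l2norm (vmask [set k]%SET (const_mx 1 : 'cV[R]_p)) = 1.
  apply/eqP; rewrite -(@eqrXn2 _ 2%N) ?l2norm_ge0// sqr_l2norm_vmask.
  by rewrite big_set1 mxE expr1n.
by rewrite !l2norm_subvec !one !mulr1.
Qed.

End RestrictedIsometry.

(** * Errors concentrated on a sparse support *)

Section Shelling.
Variables (R : realType) (p : nat) (h : 'cV[R]_p).
Implicit Types (U W : {set 'I_p}).

(** [W] collects [S] largest entries of [h] on [U], all of [U] if it has fewer;
    [v] bounds the entries left out, and [S v] the mass of the block [W] from
    below. *)
Lemma exists_largest S U : exists W (v : R),
  [/\ W \subset U, (#|W| <= S)%N, (0 < S)%N -> (0 < #|U|)%N -> (0 < #|W|)%N,
      forall i, i \in U :\: W -> `|h i 0| <= v &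
      0 <= v /\ S%:R * v <= \sum_(i in W) `|h i 0|].
Proof.
elim: S => [|S [W [v [WU WS W0 Wv [v0 Sv]]]]].
  exists finset.set0, (\sum_i `|h i 0|); split;
    rewrite ?finset.sub0set ?cards0//.
    by move=> i _; rewrite (bigD1 i)//= lerDl sumr_ge0.
  by rewrite mul0r big_set0 sumr_ge0.
have [UW|/set0Pn[i0 i0UW]] := eqVneq (U :\: W) finset.set0.
  exists W, 0; split=> //; first exact: ltnW.
  - move=> _ U0; suff -> : W = U by [].
    by apply/eqP; rewrite finset.eqEsubset WU -finset.setD_eq0 UW eqxx.
  - by move=> i; rewrite UW inE.
  - by rewrite mulr0 lexx sumr_ge0.
case: (@Order.TotalTheory.arg_maxP _ _ _ i0 (fun i => i \in U :\: W)
  (fun i => `|h i 0|)) => //= i; rewrite !inE => /andP[iW iU] imax.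
exists (i |: W)%SET, `|h i 0|; split.
- by rewrite finset.subUset finset.sub1set iU.
- by rewrite cardsU1 iW.
- by move=> _ _; rewrite cardsU1 iW.
- move=> j; rewrite !inE negb_or -andbA => /and3P[_ jW jU].
  by apply: imax; rewrite !inE jW.
- split=> //; rewrite big_setU1//= -natr1 mulrDl mul1r [leLHS]addrC lerD2l.
  apply: le_trans Sv; apply: ler_wpM2l => //.
  by apply: Wv; rewrite inE iW.
Qed.

(** A linear functional bounded by [D] times the l2 norm on sparse vectors is
    controlled by the l1 norm on arbitrary ones: cut [U] into blocks of [S]
    entries of decreasing size, and bound the l2 norm of each block by the l1
    norm of the block before it; [v] plays this part for the first block. *)
Lemma shelling (q : 'cV[R]_p -> R) (D : R) S U0 :
  {morph q : u v / u + v} -> 0 <= D -> (0 < S)%N ->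
  (forall W, W \subset U0 -> (#|W| <= S)%N ->
     `|q (vmask W h)| <= D * l2norm (vmask W h)) ->
  forall U v, U \subset U0 -> 0 <= v -> (forall i, i \in U -> `|h i 0| <= v) ->
  Num.sqrt S%:R * `|q (vmask U h)| <= D * (S%:R * v + \sum_(i in U) `|h i 0|).
Proof.
move=> qD D0 S0 qW U; have [k] := ubnP #|U|.
elim: k U => // k IH U Uk v UU0 v0 hv.
have q0 : q 0 = 0 by apply: (addrI (q 0)); rewrite -qD !addr0.
have [/eqP|U0'] := posnP #|U|.
  rewrite cards_eq0 => /eqP ->.
  have -> : vmask finset.set0 h = 0.
    by apply/matrixP => i j; rewrite !mxE inE.
  by rewrite q0 normr0 mulr0 big_set0 addr0 !mulr_ge0.
have [W [w [WU WS /(_ S0 U0') W0 Ww [w0 Sw]]]] := exists_largest S U.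
have sS0 : 0 <= Num.sqrt S%:R :> R := sqrtr_ge0 _.
have sSS : Num.sqrt S%:R * Num.sqrt S%:R = S%:R :> R.
  by rewrite -expr2 sqr_sqrtr.
have dWU : [disjoint W & U :\: W]%B.
  by rewrite finset.disjoints_subset; apply/fintype.subsetP => i iW;
    rewrite !inE iW.
have UE : U = W :|: (U :\: W).
  by rewrite -{1}(finset.setID U W) (finset.setIidPr WU).
have step1 : Num.sqrt S%:R * `|q (vmask W h)| <= D * (S%:R * v).
  apply: (@le_trans _ _ (Num.sqrt S%:R * (D * (Num.sqrt S%:R * v)))); last first.
    by rewrite mulrCA mulrA mulrA -(mulrA D) sSS mulrA.
  apply: ler_wpM2l => //.
  apply: le_trans (qW _ (fintype.subset_trans WU UU0) WS) _.
  apply: ler_wpM2l => //.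
  rewrite -(@ler_pXn2r _ 2%N) ?nnegrE ?l2norm_ge0 ?mulr_ge0// sqr_l2norm_vmask.
  apply: (@le_trans _ _ (\sum_(i in W) v ^+ 2)).
    apply: ler_sum => i iW; rewrite -[leLHS]real_normK ?num_real//.
    rewrite lerXn2r ?nnegrE//; apply: hv; exact: (fintype.subsetP WU).
  rewrite sumr_const exprMn sqr_sqrtr// -[leLHS]mulr_natl.
  by apply: ler_wpM2r; rewrite ?sqr_ge0// ler_nat.
have step2 : Num.sqrt S%:R * `|q (vmask (U :\: W) h)| <=
    D * (\sum_(i in W) `|h i 0| + \sum_(i in U :\: W) `|h i 0|).
  have UWk : (#|U :\: W| < k)%N.
    rewrite -ltnS; apply: leq_trans Uk.
    by rewrite ltnS cardsD (finset.setIidPr WU) ltn_subrL W0.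
  have := IH _ UWk w (fintype.subset_trans (finset.subsetDl _ _) UU0) w0 Ww.
  move=> /le_trans; apply; apply: ler_wpM2l => //; exact: lerD.
rewrite {1}UE vmask_disjoint// qD.
apply: (@le_trans _ _ (Num.sqrt S%:R *
  (`|q (vmask W h)| + `|q (vmask (U :\: W) h)|))).
  apply: ler_wpM2l => //; exact: ler_normD.
rewrite mulrDr mulrDr; apply: lerD => //; apply: le_trans step2 _.
by rewrite [in leRHS](big_setID W) (finset.setIidPr WU).
Qed.


End Shelling.

(** Candes-Tao bound, for a cone of aperture [c] slightly larger than one. *)
Lemma restricted_l1_bound (R : realType) n p (Z : 'M[R]_(n, p)) S
    (T : {set 'I_p}) (kappa c tau : R) (h : 'cV[R]_p) :
  (0 < S)%N -> (S + 2 * S <= p)%N -> (#|T| <= S)%N ->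
  delta Z (2 * S) + theta Z S (2 * S) <= kappa -> kappa < 1 ->
  c = 1 + (1 - kappa) / 2 ->
  \sum_(j in ~: T) `|h j 0| <= c * \sum_(j in T) `|h j 0| ->
  (forall j, `|dot (col j (standardize Z)) (standardize Z *m h)| <= tau) ->
  l1norm h <= (1 + c) * Num.sqrt S%:R *
              (Num.sqrt (2 * S)%:R * tau * 2 / (1 - kappa)).
Proof.
move=> S0 Sp TS dk k1 cE cone corr.
have p1 : (1 < p)%N by lia.
have S20 : (0 < 2 * S)%N by rewrite muln_gt0.
have d0 := delta_ge0 Z S20 (ltnW p1).
have th0 := theta_ge0 Z S0 S20 p1.
have tau0 : 0 <= tau.
  by apply: le_trans (corr (Ordinal p1)); exact: normr_ge0.
have [W [v [WT WS _ Wv [v0 Sv]]]] := exists_largest h S (~: T).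
set T01 := T :|: W; pose U := ~: T01.
pose a := vmask T01 h; pose Zs := standardize Z.
pose q v := dot (Zs *m a) (Zs *m v).
have a0 : 0 <= l2norm a := l2norm_ge0 a.
have UE : U = ~: T :\: W by rewrite /U /T01 finset.setCU finset.setDE.
have T01S : (#|T01| <= 2 * S)%N.
  by rewrite mul2n -addnn (leq_trans (leq_card_setU _ _))// leq_add.
have hE : h = a + vmask U h.
  apply/matrixP => i j; rewrite ord1 !mxE [_ \in U]inE.
  by case: ifP => _ /=; rewrite ?addr0 ?add0r.
have qD : {morph q : u v / u + v} by move=> u v'; rewrite /q mulmxDr dotDr.
have hWD (W' : {set 'I_p}) : W' \subset U -> (#|W'| <= S)%N ->
    `|q (vmask W' h)| <= theta Z S (2 * S) * l2norm a * l2norm (vmask W' h).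
  move=> W'U W'S; rewrite /q dotC mulrAC; apply: theta_upper => //.
  by rewrite finset.disjoints_subset.
have sS : 0 < Num.sqrt S%:R :> R by rewrite sqrtr_gt0 ltr0n.
(* S v is absorbed by the largest block, so the remainder is controlled by the
   l1 norm off T alone. *)
have tail : `|q (vmask U h)| <= theta Z S (2 * S) * c * l2norm a ^+ 2.
  have hv i : i \in U -> `|h i 0| <= v by rewrite UE; exact: Wv.
  rewrite -(ler_pM2l sS).
  apply: le_trans
    (shelling qD (mulr_ge0 th0 a0) S0 hWD (fintype.subxx _) v0 hv) _.
  have -> : Num.sqrt S%:R * (theta Z S (2 * S) * c * l2norm a ^+ 2) =
    theta Z S (2 * S) * l2norm a * (c * (Num.sqrt S%:R * l2norm a)) by ring.
  apply: ler_wpM2l; first exact: mulr_ge0.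
  apply: (@le_trans _ _ (\sum_(j in ~: T) `|h j 0|)).
    by rewrite [leRHS](big_setID W) (finset.setIidPr WT) -UE lerD2r.
  apply: le_trans cone _; apply: ler_wpM2l; first by rewrite cE; lra.
  apply: le_trans (sum_vmask_le_l2norm _ TS) _.
  apply: ler_wpM2l; first exact: ltW.
  exact/le_l2norm_vmask/finset.subsetUl.
have head : dot (Zs *m a) (Zs *m h) <= tau * (Num.sqrt (2 * S)%:R * l2norm a).
  rewrite dotC dot_mulmx.
  apply: (@le_trans _ _ (tau * \sum_(j in T01) `|h j 0|)); last first.
    by apply: ler_wpM2l => //; exact: sum_vmask_le_l2norm.
  rewrite mulr_sumr [leRHS]big_mkcond; apply: ler_sum => j _.
  rewrite mxE; case: ifP => _; last by rewrite mul0r.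
  apply: le_trans (ler_norm _) _; rewrite normrM mulrC.
  by apply: ler_wpM2r => //; exact: corr.
have low := delta_lower Z h T01S.
have aa : l2norm (Zs *m a) ^+ 2 = dot (Zs *m a) (Zs *m h) - q (vmask U h).
  rewrite sqr_l2norm /q -dotBr -mulmxBr; congr (dot _ (_ *m _)).
  by apply/eqP; rewrite -subr_eq opprK -hE.
have kappa1 : 0 < (1 - kappa) / 2 by lra.
(* Since [theta <= 1], enlarging [c] beyond 1 costs at most half of the gap
   between [kappa] and 1. *)
have k0 : (1 - kappa) / 2 <= 1 - (delta Z (2 * S) + theta Z S (2 * S) * c).
  have : theta Z S (2 * S) * (1 - kappa) <= 1 * (1 - kappa).
    by apply: ler_wpM2r; lra.
  rewrite cE; lra.
have a2 : (1 - kappa) / 2 * l2norm a ^+ 2 <=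
    tau * Num.sqrt (2 * S)%:R * l2norm a.
  have : - q (vmask U h) <= `|q (vmask U h)| by rewrite -normrN ler_norm.
  rewrite -/T01 -/Zs -/a aa in low.
  have := sqr_ge0 (l2norm a); nra.
have a1 : l2norm a <= Num.sqrt (2 * S)%:R * tau * 2 / (1 - kappa).
  rewrite ler_pdivlMr; last by lra.
  have [->|an0] := eqVneq (l2norm a) 0.
    by rewrite mul0r !mulr_ge0.
  have ap : 0 < l2norm a by rewrite lt_neqAle eq_sym an0.
  rewrite -(ler_pM2l ap); lra.
have c0 : 0 <= 1 + c by rewrite cE; lra.
rewrite (l1norm_split T) -mulrA.
apply: (@le_trans _ _ ((1 + c) * \sum_(j in T) `|h j 0|)).
  by rewrite mulrDl mul1r lerD2l.
apply: ler_wpM2l => //; apply: le_trans (sum_vmask_le_l2norm _ TS) _.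
apply: ler_wpM2l; first exact: ltW; apply: le_trans a1.
exact/le_l2norm_vmask/finset.subsetUl.
Qed.

(** * Lasso and Dantzig selector *)

Section Estimators.
Variables (R : realType) (n p : nat) (Z : 'M[R]_(n, p)).
Implicit Types (g gamma : 'cV[R]_p) (T : {set 'I_p}).

Lemma sqr_l2normB (u v : 'cV[R]_n) :
  l2norm (u - v) ^+ 2 = l2norm u ^+ 2 - 2 * dot u v + l2norm v ^+ 2.
Proof. by rewrite !sqr_l2norm !dotBl !dotBr (dotC v u); ring. Qed.

(** Lasso solutions satisfy the constraint of the Dantzig selector: a violated
    constraint gives a coordinate along which the objective decreases. *)
Lemma lasso_dantzig_feasible y lam g :
  0 <= lam -> lasso_solution Z y lam g -> dantzig_feasible Z y lam g.
Proof.
move=> lam0 opt j; rewrite -dotE.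
set z := col j Z; set r := y - Z *m g.
have perturb t : 0 <= - (t * dot z r) + t ^+ 2 * l2norm z ^+ 2 / 2 + lam * `|t|.
  have := opt (g + t *: delta_mx j 0).
  rewrite mulmxDr -scalemxAr -colE -/z opprD addrA -/r.
  rewrite (sqr_l2normB r) dotZr (dotC r z).
  have -> : l2norm (t *: z) ^+ 2 = t ^+ 2 * l2norm z ^+ 2.
    by rewrite !sqr_l2norm dotZl dotZr; ring.
  have : lam * l1norm (g + t *: delta_mx j 0) <= lam * (l1norm g + `|t|).
    apply: ler_wpM2l => //.
    rewrite /l1norm (bigD1 j)//= [X in _ <= X + _](bigD1 j)//= addrAC.
    apply: lerD.
      by rewrite !mxE !eqxx mulr1 ler_normD.
    rewrite le_eqVlt; apply/orP; left; apply/eqP; apply: eq_bigr => i ij.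
    by rewrite !mxE (negbTE ij) mulr0 addr0.
  lra.
rewrite leNgt; apply/negP => lamc.
set e := `|dot z r| - lam; have e0 : 0 < e by rewrite subr_gt0.
set a := l2norm z ^+ 2; have a0 : 0 <= a by rewrite sqr_ge0.
pose s := e / (a + 1).
have s0 : 0 < s by apply: divr_gt0 => //; lra.
have sa : s * a <= e.
  by rewrite /s mulrAC ler_pdivrMr; [apply: ler_wpM2l; lra|lra].
(* The step [s] along the sign of the correlation makes the linear gain [s e]
   exceed the quadratic cost [s ^+ 2 a / 2]. *)
have key : 0 <= - (s * `|dot z r|) + s ^+ 2 * a / 2 + lam * s.
  have [c0|c0] := leP 0 (dot z r).
    by have := perturb s; rewrite (ger0_norm c0) (gtr0_norm s0).
  have := perturb (- s).
  by rewrite (ltr0_norm c0) normrN (gtr0_norm s0) sqrrN mulNr mulrN.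
have : 0 <= s * (s * a / 2 - e) by move: key; rewrite /e; lra.
rewrite pmulr_rge0//; lra.
Qed.

(** The l1 norm can decrease from [gamma] to [g] only if their difference has at
    least as much mass on the support of [gamma] as off it. *)
Lemma l1norm_gap T g gamma : (forall j, j \notin T -> gamma j 0 = 0) ->
  l1norm gamma - l1norm g <=
    \sum_(j in T) `|(g - gamma) j 0| - \sum_(j in ~: T) `|(g - gamma) j 0|.
Proof.
move=> supp; rewrite !(l1norm_split T) opprD addrACA; apply: lerD.
  rewrite -sumrB; apply: ler_sum => j _; rewrite !mxE -[leRHS]normrN opprB.
  exact: lerB_dist.
rewrite -sumrB -sumrN; apply: ler_sum => j; rewrite inE => jT.
by rewrite !mxE supp// normr0 subr0 sub0r.
Qed.

Lemma lasso_basic_inequality gamma e lam M g :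
  lasso_solution Z (Z *m gamma + e) lam g ->
  (forall j, `|dot (col j Z) e| <= M) ->
  lam * (l1norm g - l1norm gamma) <= M * l1norm (g - gamma).
Proof.
move=> opt eM; have := opt gamma.
have -> : Z *m gamma + e - Z *m gamma = e by rewrite addrAC subrr add0r.
have -> : Z *m gamma + e - Z *m g = e - Z *m (g - gamma).
  by rewrite mulmxBr opprB addrA (addrC e).
rewrite sqr_l2normB; have := sqr_ge0 (l2norm (Z *m (g - gamma))).
have : dot e (Z *m (g - gamma)) <= M * l1norm (g - gamma).
  rewrite dot_mulmx /l1norm mulr_sumr; apply: ler_sum => j _.
  apply: le_trans (ler_norm _) _; rewrite normrM mulrC.
  exact: ler_wpM2r.
lra.
Qed.

End Estimators.

(** [g] solves one of the two problems with design [Z], response [y] and tuning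
    parameter [lam]. *)
Definition dantzig_or_lasso (R : realType) n p (Z : 'M[R]_(n, p))
    (y : 'cV[R]_n) (lam : R) (g : 'cV[R]_p) : Prop :=
  dantzig_solution Z y lam g \/ lasso_solution Z y lam g.

Lemma cone_condition (R : realType) n p (Z : 'M[R]_(n, p))
    (T : {set 'I_p}) (gamma : 'cV[R]_p) (e : 'cV[R]_n)
    (lam M c : R) (g : 'cV[R]_p) :
  (forall j, j \notin T -> gamma j 0 = 0) ->
  (forall j, `|dot (col j Z) e| <= M) ->
  0 < M -> 1 < c -> M * (c + 1) <= lam * (c - 1) ->
  dantzig_or_lasso Z (Z *m gamma + e) lam g ->
  \sum_(j in ~: T) `|(g - gamma) j 0| <= c * \sum_(j in T) `|(g - gamma) j 0|.
Proof.
move=> supp eM M0 c1 lamM sol; have gap := l1norm_gap g supp.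
move: gap.
set s : R := \sum_(j in T) _; set t : R := \sum_(j in ~: T) _ => gap.
have s0 : 0 <= s by exact: sumr_ge0.
have Mlam : M < lam by rewrite -(@ltr_pM2r _ (c - 1)); lra.
case: sol => [[_ opt]|opt].
  have /opt : dantzig_feasible Z (Z *m gamma + e) lam gamma.
    move=> j; rewrite -dotE addrAC subrr add0r; exact: le_trans (ltW Mlam).
  have : 0 <= (c - 1) * s by apply: mulr_ge0 => //; lra.
  lra.
have := lasso_basic_inequality opt eM.
rewrite (l1norm_split T (g - gamma)) -/s -/t => basic.
have h1 : (lam - M) * t <= (lam + M) * s.
  have : lam * (t - s) <= lam * (l1norm g - l1norm gamma).
    by apply: ler_wpM2l; lra.
  lra.
have h2 : (lam + M) * s <= (lam - M) * (c * s).
  by rewrite mulrA; apply: ler_wpM2r => //; lra.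
by rewrite -(@ler_pM2l _ (lam - M)) ?subr_gt0//; exact: le_trans h2.
Qed.

Lemma correlation_error (R : realType) n p (Z : 'M[R]_(n, p))
    (gamma : 'cV[R]_p) (e : 'cV[R]_n) (lam M : R) (g : 'cV[R]_p) :
  (forall j, `|dot (col j Z) e| <= M) -> 0 <= lam ->
  dantzig_or_lasso Z (Z *m gamma + e) lam g ->
  forall j, `|dot (col j Z) (Z *m (g - gamma))| <= lam + M.
Proof.
move=> eM lam0 sol j.
have feas : dantzig_feasible Z (Z *m gamma + e) lam g.
  by case: sol => [[]//|]; exact: lasso_dantzig_feasible.
have := feas j; rewrite -dotE => fj.
have -> : Z *m (g - gamma) = e - (Z *m gamma + e - Z *m g).
  by rewrite mulmxBr opprB opprD [RHS]addrC !addrA subrK.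
rewrite dotBr; apply: le_trans (ler_normB _ _) _.
by rewrite addrC lerD.
Qed.

Lemma l1_estimation_error (R : realType) n p (V : 'M[R]_(n, p)) (S : nat)
    (gamma : 'cV[R]_p) (e : 'cV[R]_n) (kappa c lam M : R) (g : 'cV[R]_p) :
  let Z := standardize V in
  (S + 2 * S <= p)%N -> (nnz gamma <= S)%N ->
  delta V (2 * S) + theta V S (2 * S) <= kappa -> kappa < 1 ->
  c = 1 + (1 - kappa) / 2 ->
  (forall j, `|dot (col j Z) e| <= M) ->
  0 < M -> M * (c + 1) <= lam * (c - 1) ->
  dantzig_or_lasso Z (Z *m gamma + e) lam g ->
  l1norm (g - gamma) <= (1 + c) * Num.sqrt S%:R *
              (Num.sqrt (2 * S)%:R * (lam + M) * 2 / (1 - kappa)).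
Proof.
move=> Z Sp nS dk k1 cE eM M0 lamM sol.
have c1 : 1 < c by rewrite cE; lra.
have lam0 : 0 <= lam.
  have : 0 < lam * (c - 1) by apply: lt_le_trans lamM; apply: mulr_gt0; lra.
  by rewrite pmulr_lgt0 ?subr_gt0// => /ltW.
pose T := [set i | gamma i 0 != 0]%SET.
have supp j : j \notin T -> gamma j 0 = 0 by rewrite inE negbK => /eqP.
have cone := cone_condition supp eM M0 c1 lamM sol.
have [S0|S0] := posnP S; last first.
  apply: (restricted_l1_bound S0 Sp nS dk k1 cE cone).
  exact: correlation_error.
(* [delta] and [theta] are meaningless for [S = 0], but then [gamma = 0] and the
   cone is reduced to the origin. *)
have T0 : T = finset.set0 by apply/eqP; rewrite -cards_eq0 -leqn0 -S0.
rewrite S0 sqrtr0 mulr0 mul0r (l1norm_split T).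
by move: cone; rewrite T0 big_set0 mulr0 add0r.
Qed.

(** * Moments of the normal law *)

Section NormalMoments.
Variable R : realType.
Variable s : R.
Hypothesis s0 : 0 < s.
Local Notation mu := (@lebesgue_measure R).
Local Notation N := (@normal_prob R 0 s).

(** The normal law integrates against its density, by uniqueness of the
    Radon-Nikodym derivative. *)
Lemma ge0_integral_normal_prob (f : R -> \bar R) :
  measurable_fun [set: R] f -> (forall x, 0 <= f x)%E ->
  (\int[N]_x f x = \int[mu]_x (f x * (normal_pdf 0 s x)%:E))%E.
Proof.
move=> mf f0; have dom := normal_prob_dominates (0 : R) s.
rewrite -(Radon_Nikodym_SigmaFinite.change_of_variables dom)//.
have mrn := measurable_int _ (Radon_Nikodym_SigmaFinite.f_integrable dom).
have mpdf : measurable_fun [set: R] (EFin \o normal_pdf 0 s).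
  by apply/measurable_EFinP; exact: measurable_normal_pdf.
apply: ae_eq_integral => //; [exact: emeasurable_funM|exact: emeasurable_funM|].
apply: ae_eqe_mul2l; apply: integral_ae_eq => //.
  exact: Radon_Nikodym_SigmaFinite.f_integrable.
by move=> E _ mE; rewrite -Radon_Nikodym_SigmaFinite.f_integral.
Qed.

(** The ratio of the densities of N(0, s^2) and N(0, (2s)^2) decays fast enough
    to absorb [x ^+ 2]. *)
Lemma sqr_normal_pdf_le x :
  x ^+ 2 * normal_pdf 0 s x <= 16 * s ^+ 2 * normal_pdf 0 (2 * s) x.
Proof.
have sn0 : s != 0 by rewrite gt_eqF.
have s2n0 : 2 * s != 0 by rewrite mulf_neq0 ?pnatr_eq0.
rewrite !normal_pdfE// /normal_fun !subr0.
have -> : normal_peak (2 * s) = normal_peak s / 2.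
  rewrite /normal_peak.
  have -> : (2 * s) ^+ 2 * pi *+ 2 = 2 ^+ 2 * (s ^+ 2 * pi *+ 2).
    by rewrite exprMn -mulrA -mulrnAr.
  by rewrite sqrtrM ?sqr_ge0// sqrtr_sqr ger0_norm// invfM mulrC.
(* In the variable [u] the claim reads [u <= exp (3 u)]. *)
pose u := x ^+ 2 / (8 * s ^+ 2).
have u0 : 0 <= u by rewrite divr_ge0 ?sqr_ge0// mulr_ge0 ?sqr_ge0.
have xu : x ^+ 2 = 8 * s ^+ 2 * u.
  by rewrite /u mulrC divfK// mulf_neq0 ?pnatr_eq0 ?sqrf_eq0.
have -> : - x ^+ 2 / (s ^+ 2 *+ 2) = - u + - (3 * u).
  by rewrite xu -mulr_natr; field.
have -> : - x ^+ 2 / ((2 * s) ^+ 2 *+ 2) = - u.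
  by rewrite xu -mulr_natr; field.
rewrite expRD xu.
have -> : 8 * s ^+ 2 * u * (normal_peak s * (expR (- u) * expR (- (3 * u)))) =
  (8 * s ^+ 2 * normal_peak s * expR (- u)) * (u * expR (- (3 * u))) by ring.
have -> : 16 * s ^+ 2 * (normal_peak s / 2 * expR (- u)) =
  (8 * s ^+ 2 * normal_peak s * expR (- u)) * 1 by field.
apply: ler_wpM2l.
  apply: mulr_ge0; last exact: expR_ge0.
  apply: mulr_ge0; last exact: normal_peak_ge0.
  by apply: mulr_ge0 => //; exact: sqr_ge0.
rewrite expRN ler_pdivrMr ?expR_gt0// mul1r.
by apply: le_trans (expR_ge1Dx _); lra.
Qed.

(** The constant is not optimal. *)
Lemma normal_second_moment : (\int[N]_x (x ^+ 2)%:E <= (16 * s ^+ 2)%:E)%E.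
Proof.
rewrite ge0_integral_normal_prob; last 2 first.
- by apply/measurable_EFinP; exact: exprn_measurable.
- by move=> x; rewrite lee_fin sqr_ge0.
apply: (@le_trans _ _
  (\int[mu]_x ((16 * s ^+ 2)%:E * (normal_pdf 0 (2 * s) x)%:E))%E).
  apply: ge0_le_integral => //=.
  - by move=> x _; rewrite -EFinM lee_fin mulr_ge0 ?sqr_ge0 ?normal_pdf_ge0.
  - apply/measurable_EFinP.
    apply: measurable_funM; first exact: exprn_measurable.
    exact: measurable_normal_pdf.
  - apply/measurable_EFinP; apply: measurable_funM => //.
    exact: measurable_normal_pdf.
  - by move=> x _; rewrite -!EFinM lee_fin sqr_normal_pdf_le.
rewrite ge0_integralZl//=; last 3 first.
- by apply/measurable_EFinP; exact: measurable_normal_pdf.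
- by move=> x _; rewrite lee_fin normal_pdf_ge0.
- by rewrite lee_fin mulr_ge0 ?sqr_ge0.
by rewrite integral_normal_pdf mule1.
Qed.

(** The centred normal law is symmetric. *)
Lemma normal_probN (B : set R) : measurable B -> N (-%R @^-1` B) = N B.
Proof.
move=> mB; rewrite /normal_prob.
have pdfN x : normal_pdf 0 s (- x) = normal_pdf 0 s x.
  by rewrite !normal_pdfE ?gt_eqF// /normal_fun !subr0 sqrrN.
pose neg : measurableTypeR R -> measurableTypeR R := -%R.
have mneg : measurable_fun [set: measurableTypeR R] neg.
  exact: oppr_measurable.
pose f (y : measurableTypeR R) := (normal_pdf 0 s y)%:E.
transitivity (\int[mu]_(x in neg @^-1` B) (f \o neg) x)%E.
  by apply: eq_integral => x _; rewrite /f /= pdfN.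
rewrite -(ge0_integral_pushforward mneg)//.
- by apply: eq_measure_integral => C mC _; exact: lebesgue_measureN.
- apply: measurable_funTS; apply/measurable_EFinP.
  exact: measurable_normal_pdf.
- by move=> y _; rewrite lee_fin normal_pdf_ge0.
Qed.

End NormalMoments.

(** * Independent normal noise *)

Section Independence.
Context d (T : measurableType d) (R : realType) (P : probability T R).

(** If [Y2] is independent of [Y1] and has the same law as [Z], the joint law of
    [Y1] and [Y2] is the product of the laws of [Y1] and [Z]; both facts are
    contained in the product rule assumed here. *)
Lemma joint_law_unique (Y1 Y2 Z : {RV P >-> R}) :
  (forall A B : set R, measurable A -> measurable B ->
     P (Y1 @^-1` A `&` Y2 @^-1` B) = (P (Y1 @^-1` A) * P (Z @^-1` B))%E) ->
  forall C : set (R * R), measurable C ->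
    (distribution P Y1 \x distribution P Z)%E C =
    P ((fun w => (Y1 w, Y2 w)) @^-1` C).
Proof.
move=> prodE.
have mf : measurable_fun [set: T] (fun w => (Y1 w, Y2 w)).
  exact: measurable_fun_pair.
pose f : {mfun T >-> (R * R)%type} :=
  HB.pack (fun w => (Y1 w, Y2 w)) (isMeasurableFun.Build _ _ _ _ _ mf).
apply: (@product_measure_unique _ _ _ _ _ (distribution P Y1) (distribution P Z)
  (distribution P f)).
by move=> A B mA mB; rewrite -[RHS]prodE.
Qed.

(** Independence and symmetry of [Y2] make [(Y1, Y2)] and [(Y1, - Y2)] equal in
    law, so the expectation of the product equals its opposite. *)
Lemma integral_indep_symmetric (Y1 Y2 : {RV P >-> R}) :
  P.-integrable [set: T] (fun w => (Y1 w * Y2 w)%:E) ->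
  (forall A B : set R, measurable A -> measurable B ->
     P (Y1 @^-1` A `&` Y2 @^-1` B) = (P (Y1 @^-1` A) * P (Y2 @^-1` B))%E) ->
  (forall B : set R, measurable B ->
     P (Y2 @^-1` (-%R @^-1` B)) = P (Y2 @^-1` B)) ->
  (\int[P]_w (Y1 w * Y2 w)%:E = 0)%E.
Proof.
move=> int12 prodE symE.
have mN (B : set R) : measurable B -> measurable (-%R @^-1` B : set R).
  by move=> mB; rewrite -[X in measurable X]setTI; exact: oppr_measurable.
have mf1 : measurable_fun [set: T] (fun w => (Y1 w, Y2 w)).
  exact: measurable_fun_pair.
have mf2 : measurable_fun [set: T] (fun w => (Y1 w, - Y2 w)).
  by apply: measurable_fun_pair => //; exact: measurableT_comp.
have mN2 : measurable_fun [set: T] (fun w => - Y2 w) by exact: measurableT_comp.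
pose Y2N : {RV P >-> R} := HB.pack (fun w => - Y2 w)
  (isMeasurableFun.Build _ _ _ _ _ mN2).
pose f1 : {RV P >-> (R * R)%type} :=
  HB.pack (fun w => (Y1 w, Y2 w)) (isMeasurableFun.Build _ _ _ _ _ mf1).
pose f2 : {RV P >-> (R * R)%type} :=
  HB.pack (fun w => (Y1 w, - Y2 w)) (isMeasurableFun.Build _ _ _ _ _ mf2).
have law C : measurable C -> distribution P f1 C = distribution P f2 C.
  move=> mC; rewrite /distribution /pushforward /=.
  rewrite -(joint_law_unique prodE)//.
  rewrite -(@joint_law_unique Y1 Y2N Y2)// => A B mA mB.
  rewrite -(symE B)// -prodE//; exact: mN.
pose mul (z : R * R) : \bar R := (z.1 * z.2)%:E.
have mmul : measurable_fun [set: R * R] mul.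
  apply/measurable_EFinP.
  by apply: measurable_funM; [exact: measurable_fst|exact: measurable_snd].
have I1 : (\int[P]_w (Y1 w * Y2 w)%:E = \int[distribution P f1]_z mul z)%E.
  by rewrite integral_distribution.
have I2 : (\int[distribution P f2]_z mul z = - \int[P]_w (Y1 w * Y2 w)%:E)%E.
  have eN w : ((mul \o f2) w = - (Y1 w * Y2 w)%:E)%E.
    by rewrite /mul /= mulrN.
  rewrite integral_distribution//.
    under eq_integral do rewrite eN.
    rewrite integralN//.
    exact: integrable_add_def int12.
  apply: (eq_integrable measurableT _ _ _ (integrableN int12)) => w _.
  by rewrite eN.
have I12 : (\int[distribution P f1]_z mul z =
    \int[distribution P f2]_z mul z)%E.
  by apply: eq_measure_integral => C mC _; exact: law.
have := integrable_fin_num measurableT int12.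
move: I1; rewrite I12 I2; case: (integral _ _ _) => // r [rN] _.
by congr EFin; lra.
Qed.

End Independence.

Section NormalNoise.
Context d (T : measurableType d) (R : realType) (P : probability T R).


Variables (n : nat) (X : 'I_n -> {RV P >-> R}) (s : R).
Hypothesis s0 : 0 < s.
Hypothesis lawX : forall i, has_law P (X i) (normal_prob 0 s).
Hypothesis indepX : independent P (fun i => X i : T -> R).

Lemma normal_sqr_integral i : (\int[P]_w (X i w ^+ 2)%:E <= (16 * s ^+ 2)%:E)%E.
Proof.
apply: le_trans (normal_second_moment s0).
(* The normal law lives on the sigma-algebra generated by the half-open
   intervals, so [X i] is pushed forward to that measurable space. *)
pose Xi : T -> measurableTypeR R := X i.
have mXi : measurable_fun [set: T] Xi.
  exact: (@measurable_funPT _ _ _ _ (X i)).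
have -> : (\int[P]_w (X i w ^+ 2)%:E = \int[pushforward P Xi]_x (x ^+ 2)%:E)%E.
  rewrite ge0_integral_pushforward//.
  - by apply: measurable_funTS; apply/measurable_EFinP; exact: exprn_measurable.
  - by move=> x _; rewrite lee_fin sqr_ge0.
rewrite le_eqVlt; apply/orP; left; apply/eqP.
by apply: eq_measure_integral => B mB _; exact: lawX.
Qed.

Lemma integrable_normal_mul i j :
  P.-integrable [set: T] (fun w => (X i w * X j w)%:E).
Proof.
have sqr k : P.-integrable [set: T] (fun w => (X k w ^+ 2)%:E).
  apply/integrableP; split.
    by apply/measurable_EFinP; exact: measurable_funX.
  under eq_integral do rewrite gee0_abs ?lee_fin ?sqr_ge0//.
  by apply: le_lt_trans (normal_sqr_integral k) _; rewrite ltry.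
apply: (le_integrable measurableT _ _
  (integrableD measurableT (sqr i) (sqr j))).
  by apply/measurable_EFinP; exact: measurable_funM.
move=> w _ /=; rewrite lee_fin.
rewrite [leRHS]ger0_norm ?addr_ge0 ?sqr_ge0//.
have := sqr_ge0 (`|X i w| - `|X j w|).
rewrite normrM sqrrB !real_normK ?num_real//.
have := mulr_ge0 (normr_ge0 (X i w)) (normr_ge0 (X j w)); lra.
Qed.

Lemma normal_uncorrelated i j : i != j -> (\int[P]_w (X i w * X j w)%:E = 0)%E.
Proof.
move=> ij; apply: integral_indep_symmetric; first exact: integrable_normal_mul.
- move=> A B mA mB.
  have := @indepX [set i; j]%SET (fun k => if k == i then A else B).
  rewrite big_setU1 ?inE//= big_set1 eqxx eq_sym (negbTE ij) => <-; last first.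
    by move=> k; case: ifP.
  congr (P _); apply/seteqP; split => w /=.
    move=> [wA wB] k; rewrite /= !inE => /orP[/eqP ->|/eqP ->].
      by rewrite eqxx.
    by rewrite eq_sym (negbTE ij).
  move=> h; split.
    by have := h i; rewrite /= !inE eqxx; exact.
  by have := h j; rewrite /= !inE eqxx orbT eq_sym (negbTE ij); exact.
- move=> B mB; rewrite !lawX//; first exact: normal_probN.
  by rewrite -[X in measurable X]setTI; exact: oppr_measurable.
Qed.

Lemma normal_combination_sqr (v : 'cV[R]_n) :
  (\int[P]_w ((\sum_i v i 0 * X i w) ^+ 2)%:E <=
    (16 * s ^+ 2 * \sum_i v i 0 ^+ 2)%:E)%E.
Proof.
pose F i j w := ((v i 0 * v j 0)%:E * (X i w * X j w)%:E)%E.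
have intF i j : P.-integrable [set: T] (F i j).
  exact/integrableZl/integrable_normal_mul.
have -> : (\int[P]_w ((\sum_i v i 0 * X i w) ^+ 2)%:E =
    \sum_i \sum_j \int[P]_w F i j w)%E.
  under [RHS]eq_bigr do rewrite -integral_sum//.
  rewrite -integral_sum// => [|i]; last exact: integrable_sum.
  apply: eq_integral => w _; rewrite expr2 mulr_suml -sumEFin.
  apply: eq_bigr => i _; rewrite mulr_sumr -sumEFin; apply: eq_bigr => j _.
  by rewrite /F -EFinM; congr EFin; ring.
rewrite mulr_sumr -sumEFin; apply: lee_sum => i _.
rewrite (bigD1 i)//= big1 ?adde0 => [|j ji].
  rewrite /F integralZl//; last exact: integrable_normal_mul.
  rewrite -[in leLHS]expr2 mulrC [leRHS]EFinM.
  apply: lee_wpmul2l; first by rewrite lee_fin sqr_ge0.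
  by under eq_integral do rewrite -expr2; exact: normal_sqr_integral.
rewrite /F integralZl//; last exact: integrable_normal_mul.
by rewrite normal_uncorrelated ?mule0// eq_sym.
Qed.

Lemma normal_noise_bound p (Z : 'M[R]_(n, p)) (M : R) : 0 < M ->
  (forall j, dot (col j Z) (col j Z) = 1) ->
  exists E : set T, [/\ measurable E,
    (forall w, E w -> forall j, `|dot (col j Z) (\col_i X i w)| <= M) &
    ((1 - p%:R * (16 * s ^+ 2) / M ^+ 2)%:E <= P E)%E].
Proof.
move=> M0 unit.
pose L j w := \sum_i col j Z i 0 * X i w.
pose Q w := \sum_j L j w ^+ 2.
have mL j : measurable_fun [set: T] (L j).
  by apply: measurable_sum => i; exact: measurable_funM.
have mQ : measurable_fun [set: T] Q.
  by apply: measurable_sum => j; exact: measurable_funX.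
have mE : measurable [set w | Q w <= M ^+ 2].
  rewrite [X in measurable X](_ : _ = [set: T] `&` Q @^-1` `]-oo, M ^+ 2]).
    exact: mQ.
  by rewrite setTI; apply/seteqP; split => w /=; rewrite in_itv.
have Q0 w : 0 <= Q w by apply: sumr_ge0 => j _; exact: sqr_ge0.
exists [set w | Q w <= M ^+ 2]; split=> //.
  move=> w Qw j; rewrite -(@ler_pXn2r _ 2%N) ?nnegrE ?(ltW M0)//.
  rewrite real_normK ?num_real//; apply: le_trans Qw.
  have -> : dot (col j Z) (\col_i X i w) = L j w.
    by apply: eq_bigr => i _; rewrite !mxE.
  by rewrite /Q (bigD1 j)//= lerDl sumr_ge0// => k _; exact: sqr_ge0.
have EQ : (\int[P]_w (Q w)%:E <= (p%:R * (16 * s ^+ 2))%:E)%E.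
  under eq_integral do rewrite -sumEFin.
  rewrite ge0_integral_sum//; last 2 first.
  - by move=> j; apply/measurable_EFinP; exact: measurable_funX.
  - by move=> j w _; rewrite lee_fin sqr_ge0.
  rewrite mulr_natl -[p in leRHS]card_ord -sumr_const -sumEFin.
  apply: lee_sum => j _; apply: le_trans (normal_combination_sqr _) _.
  have -> : \sum_i col j Z i 0 ^+ 2 = 1.
    by rewrite -(unit j); apply: eq_bigr => i _; rewrite expr2.
  by rewrite mulr1.
set E := [set w | _].
have PEC : (P (~` E) <= (p%:R * (16 * s ^+ 2) / M ^+ 2)%:E)%E.
  rewrite EFinM -lee_pdivrMr ?invr_gt0 ?exprn_gt0// invrK.
  apply: le_trans EQ; rewrite muleC.
  apply: (@le_trans _ _ (\int[P]_(w in ~` E) (M ^+ 2)%:E)%E).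
    by rewrite integral_cst//; exact: measurableC.
  apply: (@le_trans _ _ (\int[P]_(w in ~` E) (Q w)%:E)%E).
    apply: ge0_le_integral => //.
    - exact: measurableC.
    - by move=> w _; rewrite lee_fin sqr_ge0.
    - by apply/measurable_EFinP; exact: measurable_funTS.
    - by move=> w /= /negP; rewrite lee_fin -ltNge => /ltW.
  apply: ge0_subset_integral => //; first exact: measurableC.
    exact/measurable_EFinP.
  by move=> w _; rewrite lee_fin.
have PEfin : P E \is a fin_num by exact: fin_num_measure.
have := PEC; rewrite probability_setC// -(fineK PEfin) -EFinB !lee_fin.
by rewrite lerBlDr addrC -lerBlDr.
Qed.

End NormalNoise.

(** * The functional linear model *)

Section FunctionalModel.
Variables (R : realType) (n p : nat) (x : 'I_n -> R -> R) (b : 'I_p -> R -> R).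
Variables (A : 'M[R]_p) (beta : R -> R) (eta : 'cV[R]_p).
Hypothesis int_xb : forall i j, integrable01 (fun t => x i t * b j t).
Hypothesis int_xbeta : forall i, integrable01 (fun t => x i t * beta t).
Hypothesis unitA : A \in unitmx.
Let V := Vmat x b A.

Lemma int01_combination i (c : 'cV[R]_p) :
  integrable01 (fun t => x i t * (basis_row b t *m c) 0 0) /\
  int01 (fun t => x i t * (basis_row b t *m c) 0 0) =
    \sum_k int01 (fun t => x i t * b k t) * c k 0.
Proof.
have int_k k : (@lebesgue_measure R).-integrable `[0, 1]
    (fun t => (c k 0)%:E * (x i t * b k t)%:E)%E.
  by apply: integrableZl => //; exact: int_xb.
have E t : (x i t * (basis_row b t *m c) 0 0)%:E =
    (\sum_k (c k 0)%:E * (x i t * b k t)%:E)%E.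
  rewrite mxE mulr_sumr -sumEFin; apply: eq_bigr => k _.
  by rewrite !mxE -EFinM; congr EFin; ring.
split.
  rewrite /integrable01 (_ : EFin \o _ =
    fun t => (\sum_k (c k 0)%:E * (x i t * b k t)%:E)%E).
    by apply: integrable_sum => // k _.
  by apply/funext => t /=; rewrite E.
rewrite /int01 /Rintegral; under eq_integral do rewrite E.
rewrite integral_sum//=.
have -> : (\sum_k \int[@lebesgue_measure R]_(t in `[0%R, 1%R])
     ((c k 0)%:E * (x i t * b k t)%:E) =
   \sum_k (int01 (fun t => x i t * b k t) * c k 0)%:E)%E.
  apply: eq_bigr => k _; rewrite integralZl//; last exact: int_xb.
  rewrite mulrC EFinM /int01 /Rintegral fineK//.
  by apply: integrable_fin_num => //; exact: int_xb.
by rewrite sumEFin.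
Qed.

(** Row [i] of the design matrix integrates the [i]th predictor against the
    transformed basis, as in the denominators of [alpha]. *)
Lemma VmatE i j :
  V i j = int01 (fun t => x i t * (basis_row b t *m col j (invmx A)) 0 0).
Proof.
rewrite (int01_combination i _).2 /V /Vmat mxE.
by apply: eq_bigr => k _; rewrite !mxE.
Qed.

(** The response in the standard linear form [V gamma + es]. *)
Lemma responseE (W : Type) (eps : 'I_n -> W -> R) w :
  response x beta eps w =
    V *m (A *m eta) + \col_i eps_star x beta b eta eps i w.
Proof.
rewrite mulmxA /V /Vmat mulmxKV//.
apply/matrixP => i j; rewrite !mxE /eps_star.
have -> : int01 (fun t => x i t * residual beta b eta t) =
    int01 (fun t => x i t * beta t) -
    int01 (fun t => x i t * (basis_row b t *m eta) 0 0).
  rewrite /int01 -RintegralB//; last 2 first.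
  - exact: int_xbeta.
  - exact: (int01_combination i eta).1.
  by apply: eq_Rintegral => t _; rewrite /residual mulrBr.
rewrite (int01_combination i eta).2.
rewrite [X in _ = X + _](eq_bigr (fun k =>
  int01 (fun t => x i t * b k t) * eta k 0)).
  by rewrite addrCA addrC; congr (_ + _); rewrite addrCA subrr addr0.
by move=> k _; rewrite !mxE ord1.
Qed.

End FunctionalModel.

Section Standardization.
Variables (R : realType) (n p : nat) (V : 'M[R]_(n, p)).
Hypothesis colV : forall j, col j V != 0.

(** Coefficients for the standardized design that reproduce [V c]. *)
Definition rescale (c : 'cV[R]_p) : 'cV[R]_p :=
  \col_j (l2norm (col j V) * c j 0).

Lemma norm_col_gt0 j : 0 < l2norm (col j V).
Proof. by rewrite lt_neqAle eq_sym l2norm_eq0 colV l2norm_ge0. Qed.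

Lemma standardize_rescale c : standardize V *m rescale c = V *m c.
Proof.
apply/matrixP => i k; rewrite ord1 !mxE; apply: eq_bigr => j _; rewrite !mxE.
by rewrite mulrA divfK// gt_eqF// norm_col_gt0.
Qed.

Lemma dot_col_standardize j :
  dot (col j (standardize V)) (col j (standardize V)) = 1.
Proof.
have -> : col j (standardize V) = (l2norm (col j V))^-1 *: col j V.
  by apply/matrixP => i k; rewrite !mxE mulrC.
have n0 := norm_col_gt0 j.
by rewrite dotZl dotZr -sqr_l2norm; field; rewrite gt_eqF.
Qed.

Lemma nnz_rescale c : (nnz (rescale c) <= nnz c)%N.
Proof.
apply/subset_leq_card/fintype.subsetP => j; rewrite !inE mxE mulf_eq0 negb_or.
by case/andP.
Qed.

End Standardization.

(** With a single column the correlation with [Z h] is [h] itself. *)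
Lemma l1norm_le_correlation (R : realType) n p (Z : 'M[R]_(n, p)) (tau : R)
    (h : 'cV[R]_p) : p = 1%N ->
  (forall j, dot (col j Z) (col j Z) = 1) ->
  (forall j, `|dot (col j Z) (Z *m h)| <= tau) -> l1norm h <= tau.
Proof.
move=> p1; subst p => unit corr.
have := corr 0; rewrite dot_mulmx big_ord1 unit mulr1.
by rewrite /l1norm big_ord1.
Qed.

Section PointwiseError.
Variables (R : realType) (n p : nat) (x : 'I_n -> R -> R) (b : 'I_p -> R -> R).
Variables (A : 'M[R]_p) (beta : R -> R) (eta : 'cV[R]_p).
Hypothesis n0 : (0 < n)%N.
Hypothesis int_xb : forall i j, integrable01 (fun t => x i t * b j t).
Hypothesis unitA : A \in unitmx.
Let V := Vmat x b A.
Hypothesis colV : forall j, col j V != 0.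

Lemma weight_le_alpha t j :
  `|(basis_row b t *m invmx A) 0 j| / l2norm (col j V) <=
    alpha x b A t / Num.sqrt n%:R.
Proof.
have nR : 0 < n%:R :> R by rewrite ltr0n.
have nj k : 0 < l2norm (col k V) := norm_col_gt0 colV k.
rewrite ler_pdivlMr ?sqrtr_gt0//.
have a0 : 0 <= alpha x b A t by exact: sqrtr_ge0.
pose B k := (basis_row b t *m invmx A) 0 k.
have alpha2 : alpha x b A t ^+ 2 = \sum_k n%:R * (B k / l2norm (col k V)) ^+ 2.
  have term k : (basis_row b t *m col k (invmx A)) 0 0 ^+ 2 / (n%:R^-1 *
      \sum_i int01 (fun s =>
        x i s * (basis_row b s *m col k (invmx A)) 0 0) ^+ 2)
      = n%:R * (B k / l2norm (col k V)) ^+ 2.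
    have -> : \sum_i int01 (fun s =>
        x i s * (basis_row b s *m col k (invmx A)) 0 0) ^+ 2 =
        l2norm (col k V) ^+ 2.
      rewrite sqr_l2norm; apply: eq_bigr => i _.
      by rewrite -VmatE// !mxE expr2.
    have -> : (basis_row b t *m col k (invmx A)) 0 0 = B k.
      by rewrite /B !mxE; apply: eq_bigr => l _; rewrite !mxE.
    by field; rewrite !gt_eqF.
  rewrite /alpha sqr_sqrtr; last first.
    by apply: sumr_ge0 => k _; rewrite term mulr_ge0 ?sqr_ge0// ltW.
  by apply: eq_bigr => k _; exact: term.
rewrite -(@ler_pXn2r _ 2%N) ?nnegrE ?mulr_ge0 ?sqrtr_ge0 ?invr_ge0
  ?(ltW (nj j))//.
rewrite alpha2 (bigD1 j)//= exprMn sqr_sqrtr ?(ltW nR)//.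
rewrite [X in X <= _](_ : _ = n%:R * (B j / l2norm (col j V)) ^+ 2).
  by rewrite lerDl sumr_ge0// => k _; rewrite mulr_ge0 ?sqr_ge0// ltW.
by rewrite !exprMn real_normK ?num_real// mulrC.
Qed.

Lemma flirti_error g t :
  `|flirti V b A g t - beta t| <=
    alpha x b A t / Num.sqrt n%:R * l1norm (g - rescale V (A *m eta)) +
    `|residual beta b eta t|.
Proof.
have -> : flirti V b A g t - beta t =
   \sum_j (basis_row b t *m invmx A) 0 j / l2norm (col j V) *
     (g - rescale V (A *m eta)) j 0 - residual beta b eta t.
  rewrite /residual opprB addrA; congr (_ - _).
  have -> : (basis_row b t *m eta) 0 0 =
      \sum_j (basis_row b t *m invmx A) 0 j * (A *m eta) j 0.
    by rewrite -[in LHS](mulKmx unitA eta) (mulmxA (basis_row b t)) mxE.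
  rewrite /flirti mxE -big_split; apply: eq_bigr => j _.
  rewrite [RHS]/= !mxE; have := norm_col_gt0 colV j => nj.
  by field; rewrite gt_eqF.
apply: le_trans (ler_normB _ _) _; rewrite lerD2r.
apply: le_trans (ler_norm_sum _ _ _) _.
rewrite /l1norm mulr_sumr; apply: ler_sum => j _.
rewrite normrM ler_wpM2r// normrM normfV.
by rewrite (ger0_norm (l2norm_ge0 _)) weight_le_alpha.
Qed.

End PointwiseError.

(** * Consistency of the estimate *)

Lemma sup01_ge (R : realType) (f : R -> R) t : 0 <= t <= 1 ->
  ((f t)%:E <= sup01 f)%E.
Proof.
by move=> t01; apply: ereal_sup_ubound; exists t; rewrite //= in_itv.
Qed.

Lemma sup01_le (R : realType) (f : R -> R) (u : R) :
  (forall t, 0 <= t <= 1 -> f t <= u) -> (sup01 f <= u%:E)%E.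
Proof.
move=> fu; apply: ge_ereal_sup => _ [t + <-].
by rewrite /= in_itv /= lee_fin => /fu.
Qed.

(** This fails for [p = 1], where the logarithm vanishes. *)
Lemma tuning_eventually_ge (R : realType) (sigma L : R) (p : nat) :
  0 < sigma -> 0 <= L -> (1 < p)%N ->
  exists phi0 : R, 0 <= phi0 /\ forall phi, phi0 <= phi ->
    L <= sigma * Num.sqrt (2 * (1 + phi) * ln p%:R).
Proof.
move=> s0 L0 p1; have lnp : 0 < ln p%:R :> R by rewrite ln_gt0// ltr1n.
exists ((L / sigma) ^+ 2 / ln p%:R); split.
  by apply: divr_ge0; rewrite ?sqr_ge0// ltW.
move=> phi; rewrite ler_pdivrMr// => phiL.
rewrite mulrC -ler_pdivrMr// -[leLHS]ger0_norm ?divr_ge0 ?(ltW s0)// -sqrtr_sqr.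
apply: ler_wsqrtr; apply: (le_trans phiL).
have phi0 : 0 <= phi * ln p%:R.
  by apply: le_trans phiL; exact: sqr_ge0.
lra.
Qed.

Theorem theorem5 (R : realType)
  (d : nat -> measure_display)
  (Omega : forall n : nat, measurableType (d n))
  (P : forall n : nat, probability (Omega n) R)
  (X : forall n : nat, 'I_n -> R -> R)
  (beta : R -> R)
  (eps : forall n : nat, 'I_n -> {RV (P n) >-> R})
  (b : forall p : nat, 'I_p -> R -> R)
  (A : forall p : nat, 'M[R]_p)
  (eta : forall p : nat, 'cV[R]_p)
  (Sp : nat -> nat) :
  let V n p : 'M[R]_(n, p) := Vmat (X n) (b p) (A p) in
  (forall n i, integrable01 (fun t => X n i t * beta t)) ->
  (forall n i p j, integrable01 (fun t => X n i t * b p j t)) ->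
  (forall p, A p \in unitmx) ->
  (forall p, (0 < p)%N -> (nnz (A p *m eta p)%R <= Sp p)%N) ->
  (forall n p, (0 < n)%N -> (0 < p)%N -> forall j : 'I_p, col j (V n p) != 0) ->
  (* (A-1) *)
  forall S : nat, (forall p, (0 < p)%N -> (Sp p <= S)%N) ->
  (* (A-2) *)
  forall m H : R, 0 < m ->
  (forall p, (0 < p)%N ->
     (omega beta (b p) (eta p) <= (H / p%:R `^ m)%:E)%E) ->
  (* (A-3) *)
  forall t : R, 0 <= t <= 1 ->
  (exists bt C : R, forall n p, (0 < n)%N -> (0 < p)%N ->
     p%:R `^ (- bt) * alpha (X n) (b p) (A p) t <= C) ->
  (* (A-4) *)
  (exists c C : R, forall n p, (0 < n)%N -> (0 < p)%N ->
     ((p%:R `^ (- c))%:E * sup01 (alpha (X n) (b p) (A p)) <= C%:E)%E) ->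
  (* (A-5) *)
  forall p : nat, (0 < p)%N -> (S + 2 * S <= p)%N ->
  (exists kappa : R, kappa < 1 /\
     \forall n \near \oo, delta (V n p) (2 * S) + theta (V n p) S (2 * S) <= kappa) ->
  forall sigma2 : R, 0 < sigma2 ->
  let es n := eps_star (X n) beta (b p) (eta p) (fun i => eps n i : Omega n -> R) in
  (forall n, independent (P n) (es n)) ->
  (forall n i, has_law (P n) (es n i) (normal_prob 0 sigma2)) ->
  (\forall n \near \oo,
     delta (V n p) (2 * Sp p) + theta (V n p) (Sp p) (2 * Sp p) < 1) ->
  let lambda phi : R := sigma2 * Num.sqrt (2 * (1 + phi) * ln p%:R) in
  let Vt n := standardize (V n p) in
  let Y n := response (X n) beta (fun i => eps n i : Omega n -> R) in
  forall g : R -> forall n : nat, Omega n -> 'cV[R]_p,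
  (forall phi n w, 0 <= phi ->
     dantzig_solution (Vt n) (Y n w) (lambda phi) (g phi n w)) \/
  ((forall phi n w, 0 <= phi ->
     lasso_solution (Vt n) (Y n w) (lambda phi) (g phi n w)) /\
   (forall phi, 0 <= phi -> \forall n \near \oo,
      {ae P n, forall w, lasso_condition (Vt n) (g phi n w)})) ->
  let beta_hat phi n w := flirti (V n p) (b p) (A p) (g phi n w) in
  forall rho : R, 0 < rho ->
  exists phi0 : R, 0 <= phi0 /\ forall phi, phi0 <= phi ->
  exists (K : R) (N : nat), forall n, (N <= n)%N ->
    let bound : R := K / Num.sqrt n%:R + H / p%:R `^ m in
    with_prob_at_least (P n) (1 - rho)
      [set w | `|beta_hat phi n w t - beta t| <= bound /\
               (sup01 (fun s => `|beta_hat phi n w s - beta s|%R) <= bound%:E)%E].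
Proof.
move=> V int_xbeta int_xb unitA nnzA colV S SpS m H m0 omegaH t t01 _ alphaC
  p p0 Sp3 [kappa [k1 dk]] sigma2 s0 es indep law _ lambda Vt Y g sol beta_hat
  rho rho0.
have [c [C alphaS]] := alphaC; clear alphaC.
pose gam n := rescale (V n p) (A p *m eta p).
pose noise n w := \col_i es n i w.
have YE n w : (0 < n)%N -> Y n w = Vt n *m gam n + noise n w.
  move=> n0; rewrite /Y /Vt /gam standardize_rescale; last first.
    by move=> j; exact: colV.
  apply: responseE; [|exact: int_xbeta|exact: unitA].
  by move=> i j; exact: int_xb.
have solve phi n w : 0 <= phi ->
    dantzig_or_lasso (Vt n) (Y n w) (lambda phi) (g phi n w).
  by move=> phi0; case: sol => [sol|[sol _]]; [left|right]; exact: sol.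
have lam0 phi : 0 <= lambda phi by rewrite mulr_ge0 ?sqrtr_ge0// ltW.
have unit n : (0 < n)%N -> forall j, dot (col j (Vt n)) (col j (Vt n)) = 1.
  by move=> n0; apply: dot_col_standardize => j; exact: colV.
pose Ca := C * p%:R `^ c.
have alphaCa n s : (0 < n)%N -> 0 <= s <= 1 -> alpha (X n) (b p) (A p) s <= Ca.
  move=> n0 s01; have pc : 0 < p%:R `^ (- c) :> R by rewrite powR_gt0// ltr0n.
  have : ((p%:R `^ (- c))%:E * (alpha (X n) (b p) (A p) s)%:E <= C%:E)%E.
    apply: le_trans (alphaS n p n0 p0).
    by apply: lee_wpmul2l; [rewrite lee_fin ltW|exact: sup01_ge].
  rewrite -EFinM lee_fin mulrC -ler_pdivlMr// => /le_trans; apply.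
  by rewrite powRN invrK.
have omegaH' s : 0 <= s <= 1 ->
    `|residual beta (b p) (eta p) s| <= H / p%:R `^ m.
  move=> s01; rewrite -lee_fin; apply: le_trans (omegaH p p0).
  exact: (sup01_ge (fun u => `|residual beta (b p) (eta p) u|)).
(* Chosen so that the failure probability in [normal_noise_bound] is [rho]. *)
pose M := Num.sqrt (p%:R * (16 * sigma2 ^+ 2) / rho).
have M2 : 0 < p%:R * (16 * sigma2 ^+ 2) / rho.
  by rewrite divr_gt0// !mulr_gt0 ?ltr0n// exprn_gt0.
have M0 : 0 < M by rewrite sqrtr_gt0.
have finish phi K0 N : (forall n, (N <= n)%N -> (0 < n)%N -> forall w,
      (forall j, `|dot (col j (Vt n)) (noise n w)| <= M) ->
      l1norm (g phi n w - gam n) <= K0) ->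
    exists (K : R) (N : nat), forall n, (N <= n)%N ->
      let bound : R := K / Num.sqrt n%:R + H / p%:R `^ m in
      with_prob_at_least (P n) (1 - rho)
      [set w | `|beta_hat phi n w t - beta t| <= bound /\
               (sup01 (fun s => `|beta_hat phi n w s - beta s|%R) <= bound%:E)%E].
  move=> l1K; exists (Ca * K0), (maxn N 1) => n.
  rewrite geq_max => /andP[Nn n0] bound.
  have mes i : measurable_fun [set: Omega n] (es n i).
    by apply: measurable_funD; [exact: measurable_funPT|exact: measurable_cst].
  pose Z i : {RV (P n) >-> R} :=
    HB.pack (es n i) (isMeasurableFun.Build _ _ _ _ _ (mes i)).
  have [E [mE EM PE]] := @normal_noise_bound _ _ _ (P n) n Z sigma2
    s0 (law n) (indep n) p (Vt n) M M0 (unit n n0).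
  exists E; split=> //.
    move=> w Ew; have l1 := l1K n Nn n0 w (EM w Ew).
    have K00 : 0 <= K0 by apply: le_trans l1; exact: sumr_ge0.
    have err s : 0 <= s <= 1 -> `|beta_hat phi n w s - beta s| <= bound.
      move=> s01; apply: (le_trans (flirti_error beta (eta p) n0
        (fun i j => int_xb n i p j) (unitA p) (colV n p n0 p0) (g phi n w) s)).
      apply: lerD (omegaH' s s01); rewrite mulrAC.
      have a0 : 0 <= alpha (X n) (b p) (A p) s by exact: sqrtr_ge0.
      apply: ler_wpM2r; first by rewrite invr_ge0 sqrtr_ge0.
      apply: ler_pM => //; first exact: sumr_ge0.
      exact: alphaCa.
    by split; [exact: err|exact: sup01_le].
  apply: le_trans PE; rewrite lee_fin sqr_sqrtr ?(ltW M2)//.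
  rewrite le_eqVlt; apply/orP; left; apply/eqP; congr (_ - _).
  rewrite invf_div mulrCA divff ?mulr1//.
  by rewrite gt_eqF// !mulr_gt0 ?ltr0n// exprn_gt0.
(* For [p = 1] the tuning parameter is zero and no value of [phi] gives the cone
   condition; the correlation bound alone is enough. *)
have [p1|p1] := leqP p 1.
  exists 0; split=> // phi phi0.
  apply: (finish phi (lambda phi + M) 0%N) => n _ n0 w wM.
  apply: (@l1norm_le_correlation _ n p (Vt n)); [|exact: unit|].
    by apply/eqP; rewrite eqn_leq p1.
  by apply: (correlation_error wM (lam0 phi)); rewrite -YE//; exact: solve.
pose a := 1 + (1 - kappa) / 2.
have a1 : 0 < a - 1 by rewrite /a; lra.
have L0 : 0 <= M * (a + 1) / (a - 1).
  by apply: divr_ge0; [apply: mulr_ge0; [exact: ltW|lra]|exact: ltW].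
have [phi0 [phi00 lamL]] := tuning_eventually_ge s0 L0 p1.
exists phi0; split=> // phi phi0phi.
have [N _ dkN] := dk.
apply: (finish phi ((1 + a) * Num.sqrt S%:R *
   (Num.sqrt (2 * S)%:R * (lambda phi + M) * 2 / (1 - kappa))) N)
  => n Nn n0 w wM.
apply: (l1_estimation_error Sp3 _ (dkN n Nn) k1 (erefl a) wM M0).
- apply: leq_trans (nnz_rescale _ _) _; apply: leq_trans (nnzA p p0) _.
  exact: SpS.
- by rewrite -ler_pdivrMr//; exact: lamL.
- by rewrite -YE//; apply: solve; exact: le_trans phi0phi.
Qed.
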